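(* Let $(W,R)$, with $W=\{W_j^n\}_{0\le j\le M,\,0\le n\le N}$ and $R=\{R^n\}_{0\le n\le N}$, be the solution of the finite difference scheme (S1) described in the context. If $\Delta t<1/L$, then $$W_j^n>0,\qquad 1\le n\le N,\quad 0\le j\le M-1,$$ and $$R^n>R^{n-1},\qquad 1\le n\le N.$$
   Context: Data: $d,\mu,h_0,T,L$ are positive constants; $f:\mathbb{R}\to\mathbb{R}$ is differentiable and satisfies $-Lu\le f(u)\le Lu$ and $|f'(u)|\le L$ for all $u\ge 0$. The initial function satisfies $u_0\in C^2([0,h_0])$, $u_0'(0)=0$, $u_0(h_0)=0$, and $u_0(x)>0$ for $0\le x<h_0$. Mesh: $M,N$ are positive integers, $\Delta z=1/M$, $\Delta t=T/N$, $z_j=j\Delta z$ for $0\le j\le M$. Difference operators: $\delta_t U_j^n=\frac{U_j^n-U_j^{n-1}}{\Delta t}$, $\delta_t Q^n=\frac{Q^n-Q^{n-1}}{\Delta t}$, $\delta_z U_{j+\frac12}^n=\frac{U_{j+1}^n-U_j^n}{\Delta z}$, $\delta_z^2U_0^n=\frac{2}{\Delta z}\delta_zU_{\frac12}^n$, and $\delta_z^2U_j^n=\frac1{\Delta z}\bigl(\delta_zU_{j+\frac12}^n-\delta_zU_{j-\frac12}^n\bigr)$ for $1\le j\le M-1$. Scheme (S1) (a discretization of the reaction-diffusion problem $u_t=du_{xx}+f(u)$ on $0<x<h(t)$, $u_x(t,0)=0$, $u(t,h(t))=0$, $h'(t)=-\mu u_x(t,h(t))$, $h(0)=h_0$, $u(0,x)=u_0(x)$,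 after the change of variables $z=x/h(t)$, $w(t,z)=u(t,x)$, $r=h^2$; $W_j^n$ approximates $w(t_n,z_j)$ and $R^n$ approximates $r(t_n)$, where $t_n=n\Delta t$): the initial values are $R^0=h_0^2$ and $W_j^0=u_0(z_jh_0)$, $0\le j\le M$, and for $1\le n\le N$ $$R^n\delta_tW_0^n-d\,\delta_z^2W_0^n=R^nf(W_0^{n-1}),$$ $$R^n\delta_tW_j^n-\frac{z_j\,\delta_tR^n}{2}\,\delta_zW_{j+\frac12}^n-d\,\delta_z^2W_j^n=R^nf(W_j^{n-1}),\quad 1\le j\le M-1,$$ $$\delta_tR^n=-2\mu\,\delta_zW_{M-\frac12}^{n-1},\qquad W_M^n=0.$$ *)

(* Defs.v *)
From Stdlib Require Import Reals.
From Coquelicot Require Import Coquelicot.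
Open Scope R_scope.

(* Derivatives and continuity are relative to [a, b], hence one-sided at the
   end points; the values of g outside [a, b] are irrelevant. *)
Definition C2_on (a b : R) (g : R -> R) : Prop :=
  exists g1 g2 : R -> R, forall x : R, a <= x <= b ->
    D_in g g1 (fun y => a <= y <= b) x /\
    D_in g1 g2 (fun y => a <= y <= b) x /\
    continue_in g2 (fun y => a <= y <= b) x.

(* Grid functions are written W n j with n the time level and j the space
   index; only the values with n <= N and j <= M are ever constrained. *)

Definition delta_t (Dt : R) (Q : nat -> R) (n : nat) : R :=
  (Q n - Q (n - 1)%nat) / Dt.

(* delta_z Dz U j is the difference quotient centred at the half-integer
   index j + 1/2. *)
Definition delta_z (Dz : R) (U : nat -> R) (j : nat) : R :=
  (U (j + 1)%nat - U j) / Dz.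

Definition delta_zz (Dz : R) (U : nat -> R) (j : nat) : R :=
  match j with
  | O => 2 / Dz * delta_z Dz U 0
  | S i => 1 / Dz * (delta_z Dz U (S i) - delta_z Dz U i)
  end.

Record scheme_S1 (d mu h0 T : R) (f u0 : R -> R) (M N : nat)
    (W : nat -> nat -> R) (R_ : nat -> R) : Prop := {
  S1_init_R : R_ 0%nat = h0 ^ 2;
  S1_init_W : forall j : nat, (j <= M)%nat ->
    W 0%nat j = u0 (INR j * (1 / INR M) * h0);
  S1_left : forall n : nat, (1 <= n <= N)%nat ->
    let Dz := 1 / INR M in let Dt := T / INR N in
    R_ n * delta_t Dt (fun m => W m 0%nat) n - d * delta_zz Dz (W n) 0
      = R_ n * f (W (n - 1)%nat 0%nat);
  S1_interior : forall n j : nat, (1 <= n <= N)%nat -> (1 <= j <= M - 1)%nat ->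
    let Dz := 1 / INR M in let Dt := T / INR N in let z := INR j * Dz in
    R_ n * delta_t Dt (fun m => W m j) n
      - z * delta_t Dt R_ n / 2 * delta_z Dz (W n) j
      - d * delta_zz Dz (W n) j
      = R_ n * f (W (n - 1)%nat j);
  S1_front : forall n : nat, (1 <= n <= N)%nat ->
    let Dz := 1 / INR M in let Dt := T / INR N in
    delta_t Dt R_ n = - 2 * mu * delta_z Dz (W (n - 1)%nat) (M - 1);
  S1_right : forall n : nat, (1 <= n <= N)%nat -> W n M = 0
}.

(* Main.v *)
Require Import Defs.
From Stdlib Require Import Reals Lra Lia.
From Coquelicot Require Import Coquelicot.
Open Scope R_scope.

(** The proof is a discrete minimum principle, run one time level at a time.

    Suppose level [n - 1] is positive to the left of the front and vanishes at
    the front.  The front equation is explicit, so [R_ n - R_ (n - 1)] is a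
    positive multiple of [W (n - 1) (M - 1)]: the front advances
    ([front_advances]), and in particular [R_ n] is positive.

    Diffusion and convection are implicit, and both have the good sign at a
    minimum of [W n].  The second difference is nonnegative there; so is the
    forward difference, and it is multiplied by the nonnegative speed
    [z * delta_t Dt R_ n / 2] precisely because the front advances (the scheme
    is upwind).  Hence at a minimum [j] left of the front only the explicit
    reaction can lower the solution ([lower_bound_at_min]):
    [W n j >= W (n - 1) j + Dt * f (W (n - 1) j) >= (1 - L * Dt) * W (n - 1) j],
    which is positive since [Dt < 1 / L].  As [W n M = 0], a nonpositive value
    left of the front would produce a nonpositive global minimum there, a
    contradiction ([positivity_step]). *)

Lemma finite_argmin (U : nat -> R) (m : nat) :
  exists j, (j <= m)%nat /\ forall k, (k <= m)%nat -> U j <= U k.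
Proof.
  induction m as [|m [j [Hj Hmin]]].
  - exists 0%nat; split; [lia|].
    intros k Hk; replace k with 0%nat by lia; lra.
  - destruct (Rle_dec (U j) (U (S m))) as [Hle|Hgt].
    + exists j; split; [lia|]; intros k Hk.
      destruct (Nat.eq_dec k (S m)) as [->|Hne]; [lra | apply Hmin; lia].
    + exists (S m); split; [lia|]; intros k Hk.
      destruct (Nat.eq_dec k (S m)) as [->|Hne]; [lra|].
      assert (U j <= U k) by (apply Hmin; lia); lra.
Qed.

Lemma delta_z_nonneg (Dz : R) (U : nat -> R) (j : nat) :
  0 < Dz -> U j <= U (j + 1)%nat -> 0 <= delta_z Dz U j.
Proof.
  intros HDz Hle; unfold delta_z; apply Rdiv_le_0_compat; lra.
Qed.

(** At [j = 0] there is no left neighbour: the reflecting boundary condition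
    makes the second difference a multiple of the forward difference. *)
Lemma delta_zz_nonneg_at_min (Dz : R) (U : nat -> R) (m j : nat) :
  0 < Dz -> (j < m)%nat -> (forall k, (k <= m)%nat -> U j <= U k) ->
  0 <= delta_zz Dz U j.
Proof.
  intros HDz Hj Hmin.
  assert (Hfwd : 0 <= delta_z Dz U j)
    by (apply delta_z_nonneg; [lra | apply Hmin; lia]).
  destruct j as [|i]; cbn [delta_zz].
  - apply Rmult_le_pos; [apply Rdiv_le_0_compat; lra | exact Hfwd].
  - assert (Hbwd : 0 <= - delta_z Dz U i).
    { replace (- delta_z Dz U i) with ((U i - U (S i)) / Dz)
        by (unfold delta_z; rewrite Nat.add_1_r; field; lra).
      assert (U (S i) <= U i) by (apply Hmin; lia).
      apply Rdiv_le_0_compat; lra. }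
    apply Rmult_le_pos; [apply Rdiv_le_0_compat; lra | lra].
Qed.

(** The explicit reaction step loses at most the factor [1 - L * Dt], so the
    restriction on the time step is exactly what keeps it positive. *)
Lemma explicit_reaction_pos (L Dt u v : R) :
  0 < L -> 0 < Dt -> Dt < 1 / L -> 0 < u -> - L * u <= v -> 0 < u + Dt * v.
Proof.
  intros HL HDt Hlt Hu Hv.
  assert (HLDt : L * Dt < 1).
  { replace 1 with (L * (1 / L)) by (field; lra).
    apply Rmult_lt_compat_l; assumption. }
  assert (Dt * (- L * u) <= Dt * v) by (apply Rmult_le_compat_l; lra).
  assert (0 < (1 - L * Dt) * u) by (apply Rmult_lt_0_compat; lra).
  lra.
Qed.

(** Dividing the evolution equation by the positive [r] and multiplying by
    [Dt] preserves the sign of the transport terms collected in [g]. *)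
Lemma evolution_lower_bound (r Dt w v g s : R) :
  0 < r -> 0 < Dt -> 0 <= g -> r * ((w - v) / Dt) - g = r * s ->
  v + Dt * s <= w.
Proof.
  intros Hr HDt Hg Heq.
  assert (Hw : w = v + Dt * s + g * (Dt / r)).
  { replace g with (r * ((w - v) / Dt) - r * s) by lra.
    field; lra. }
  assert (0 <= g * (Dt / r))
    by (apply Rmult_le_pos; [exact Hg | apply Rdiv_le_0_compat; lra]).
  lra.
Qed.

Section Scheme.

Variables (d mu h0 T : R) (f u0 : R -> R) (M N : nat).
Variables (W : nat -> nat -> R) (R_ : nat -> R).
Hypotheses (hd : 0 < d) (hmu : 0 < mu) (hT : 0 < T).
Hypotheses (hM : (0 < M)%nat) (hN : (0 < N)%nat).
Hypothesis hS1 : scheme_S1 d mu h0 T f u0 M N W R_.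

Lemma mesh_pos : 0 < 1 / INR M /\ 0 < T / INR N.
Proof.
  split; apply Rdiv_lt_0_compat; try lra; apply lt_0_INR; assumption.
Qed.

(** This combines the prescribed boundary value with [u0 h0 = 0]: the boundary
    condition of the scheme only starts at level 1. *)
Lemma front_value (n : nat) : u0 h0 = 0 -> (n <= N)%nat -> W n M = 0.
Proof.
  intros Hu Hn; destruct n as [|n].
  - rewrite (S1_init_W _ _ _ _ _ _ _ _ _ _ hS1) by lia.
    replace (INR M * (1 / INR M) * h0) with h0; [exact Hu|].
    field; apply not_0_INR; lia.
  - apply (S1_right _ _ _ _ _ _ _ _ _ _ hS1); lia.
Qed.

Lemma front_advances (n : nat) :
  (1 <= n <= N)%nat -> W (n - 1)%nat M = 0 -> 0 < W (n - 1)%nat (M - 1)%nat ->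
  0 < delta_t (T / INR N) R_ n.
Proof.
  intros Hn HM HW; destruct mesh_pos as [HDz _].
  pose proof (S1_front _ _ _ _ _ _ _ _ _ _ hS1 n Hn) as Heq; cbv zeta in Heq.
  rewrite Heq; unfold delta_z.
  replace (M - 1 + 1)%nat with M by lia; rewrite HM.
  replace (- 2 * mu * ((0 - W (n - 1)%nat (M - 1)%nat) / (1 / INR M)))
    with (2 * mu * (W (n - 1)%nat (M - 1)%nat / (1 / INR M)))
    by (unfold Rdiv; ring).
  apply Rmult_lt_0_compat; [lra | apply Rdiv_lt_0_compat; lra].
Qed.

Lemma increasing_of_delta_t_pos (n : nat) :
  0 < delta_t (T / INR N) R_ n -> R_ (n - 1)%nat < R_ n.
Proof.
  intros Hpos; destruct mesh_pos as [_ HDt].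
  apply (Rmult_lt_compat_r _ _ _ HDt) in Hpos; revert Hpos.
  unfold delta_t; generalize (T / INR N), HDt; intros Dt HDt'.
  replace ((R_ n - R_ (n - 1)%nat) / Dt * Dt) with (R_ n - R_ (n - 1)%nat)
    by (field; lra).
  lra.
Qed.

(** At a minimum of the new level the implicit diffusion and upwind convection
    terms can only push the solution up, leaving the explicit reaction step as
    a lower bound. *)
Lemma lower_bound_at_min (n j : nat) :
  (1 <= n <= N)%nat -> (j < M)%nat ->
  0 < R_ n -> 0 < delta_t (T / INR N) R_ n ->
  (forall k, (k <= M)%nat -> W n j <= W n k) ->
  W (n - 1)%nat j + T / INR N * f (W (n - 1)%nat j) <= W n j.
Proof.
  intros Hn Hj HR Hdt Hmin; destruct mesh_pos as [HDz HDt].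
  pose proof (delta_zz_nonneg_at_min _ _ _ _ HDz Hj Hmin) as Hzz.
  assert (Hz : 0 <= delta_z (1 / INR M) (W n) j)
    by (apply delta_z_nonneg; [exact HDz | apply Hmin; lia]).
  assert (Hdiff : 0 <= d * delta_zz (1 / INR M) (W n) j)
    by (apply Rmult_le_pos; lra).
  destruct j as [|i].
  - pose proof (S1_left _ _ _ _ _ _ _ _ _ _ hS1 n Hn) as Heq; cbv zeta in Heq.
    exact (evolution_lower_bound _ _ _ _ _ _ HR HDt Hdiff Heq).
  - pose proof (S1_interior _ _ _ _ _ _ _ _ _ _ hS1 n (S i) Hn ltac:(lia))
      as Heq; cbv zeta in Heq.
    assert (Hconv : 0 <= INR (S i) * (1 / INR M) * delta_t (T / INR N) R_ n / 2
                         * delta_z (1 / INR M) (W n) (S i)).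
    { apply Rmult_le_pos; [|exact Hz].
      apply Rdiv_le_0_compat; [|lra].
      apply Rmult_le_pos; [|lra].
      apply Rmult_le_pos; [apply pos_INR | lra]. }
    refine (evolution_lower_bound _ _ _ _ _ _ HR HDt
              (Rplus_le_le_0_compat _ _ Hconv Hdiff) _).
    rewrite <- Heq; unfold delta_t; ring.
Qed.

Lemma positivity_step (L : R) (n : nat) :
  0 < L -> T / INR N < 1 / L -> (forall u, 0 <= u -> - L * u <= f u) ->
  (1 <= n <= N)%nat -> 0 < R_ n -> 0 < delta_t (T / INR N) R_ n ->
  (forall j, (j < M)%nat -> 0 < W (n - 1)%nat j) ->
  forall j, (j < M)%nat -> 0 < W n j.
Proof.
  intros HL Hlt Hf Hn HR Hdt Hprev j Hj; destruct mesh_pos as [_ HDt].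
  destruct (Rlt_dec 0 (W n j)) as [Hpos|Hneg]; [exact Hpos | exfalso].
  (* The point [j] guarantees that the minimum over the indices below [M] is
     nonpositive, hence also a minimum over all indices up to [M]. *)
  destruct (finite_argmin (W n) (M - 1)) as [i [Hi Hmin]].
  assert (Hle : W n i <= W n j) by (apply Hmin; lia).
  assert (Hglobal : forall k, (k <= M)%nat -> W n i <= W n k).
  { intros k Hk; destruct (Nat.eq_dec k M) as [->|Hne]; [|apply Hmin; lia].
    rewrite (S1_right _ _ _ _ _ _ _ _ _ _ hS1 n Hn); lra. }
  assert (Hi' : (i < M)%nat) by lia.
  pose proof (lower_bound_at_min n i Hn Hi' HR Hdt Hglobal) as Hlow.
  pose proof (Hprev i Hi') as Hu.
  pose proof (explicit_reaction_pos _ _ _ _ HL HDt Hlt Hu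
                (Hf _ (Rlt_le _ _ Hu))).
  lra.
Qed.

End Scheme.

Theorem theorem3p1 (d mu h0 T L : R) (f u0 : R -> R) (M N : nat)
  (W : nat -> nat -> R) (R_ : nat -> R)
  (hd : 0 < d) (hmu : 0 < mu) (hh0 : 0 < h0) (hT : 0 < T) (hL : 0 < L)
  (hf_diff : forall u : R, ex_derive f u)
  (hf_bound : forall u : R, 0 <= u -> - L * u <= f u <= L * u)
  (hf_deriv : forall u : R, 0 <= u -> Rabs (Derive f u) <= L)
  (hu0_C2 : C2_on 0 h0 u0)
  (hu0_deriv0 : D_in u0 (fun _ => 0) (fun x => 0 <= x <= h0) 0)
  (hu0_h0 : u0 h0 = 0)
  (hu0_pos : forall x : R, 0 <= x < h0 -> 0 < u0 x)
  (hM : (0 < M)%nat) (hN : (0 < N)%nat)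
  (hS1 : scheme_S1 d mu h0 T f u0 M N W R_)
  (hDt : T / INR N < 1 / L) :
  (forall n j : nat, (1 <= n <= N)%nat -> (0 <= j <= M - 1)%nat -> W n j > 0) /\
  (forall n : nat, (1 <= n <= N)%nat -> R_ n > R_ (n - 1)%nat).
Proof.
  destruct (mesh_pos T M N hT hM hN) as [HDz HDt].
  assert (Hf : forall u, 0 <= u -> - L * u <= f u)
    by (intros u Hu; apply hf_bound; exact Hu).
  assert (Hadv : forall n, (1 <= n <= N)%nat ->
            (forall j, (j < M)%nat -> 0 < W (n - 1)%nat j) ->
            0 < delta_t (T / INR N) R_ n).
  { intros n Hn Hprev.
    apply (front_advances d mu h0 T f u0 M N W R_); try assumption.
    - apply (front_value d mu h0 T f u0 M N W R_); try assumption; lia.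
    - apply Hprev; lia. }
  (* Positivity of [R_ n] is carried along: it is needed to divide the
     evolution equations by it. *)
  assert (Hinv : forall n, (n <= N)%nat ->
            0 < R_ n /\ forall j, (j < M)%nat -> 0 < W n j).
  { induction n as [|n IHn]; intros Hn.
    - split.
      + rewrite (S1_init_R _ _ _ _ _ _ _ _ _ _ hS1); apply pow_lt; exact hh0.
      + intros j Hj; rewrite (S1_init_W _ _ _ _ _ _ _ _ _ _ hS1) by lia.
        assert (HMpos : 0 < INR M) by (apply lt_0_INR; exact hM).
        assert (Hz : INR j * (1 / INR M) < 1).
        { replace 1 with (INR M * (1 / INR M)) at 2 by (field; lra).
          apply Rmult_lt_compat_r; [exact HDz | apply lt_INR; exact Hj]. }
        assert (Hz0 : 0 <= INR j * (1 / INR M))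
          by (apply Rmult_le_pos; [apply pos_INR | lra]).
        apply hu0_pos; split; [apply Rmult_le_pos; lra|].
        rewrite <- (Rmult_1_l h0) at 2.
        apply Rmult_lt_compat_r; assumption.
    - destruct IHn as [HR HW]; [lia|].
      assert (Hprev : forall j, (j < M)%nat -> 0 < W (S n - 1)%nat j)
        by (replace (S n - 1)%nat with n by lia; exact HW).
      assert (Hdt : 0 < delta_t (T / INR N) R_ (S n))
        by (apply Hadv; [lia | exact Hprev]).
      assert (HR' : 0 < R_ (S n)).
      { pose proof (increasing_of_delta_t_pos T M N R_ hT hM hN (S n) Hdt) as Hlt.
        replace (S n - 1)%nat with n in Hlt by lia; lra. }
      split; [exact HR'|].
      apply (positivity_step d mu h0 T f u0 M N W R_) with (L := L);
        try assumption; lia. }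
  split.
  - intros n j Hn Hj; apply Hinv; lia.
  - intros n Hn; apply (increasing_of_delta_t_pos T M N R_ hT hM hN).
    apply Hadv; [exact Hn|]; apply Hinv; lia.
Qed.
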